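(* For all integers $n \geq 1$ and $i \geq 0$, the total number of vertices of outdegree $i$ among all plane trees with $n$ edges (that is, the number of pairs $(T,v)$ where $T$ is a plane tree with $n$ edges and $v$ is a vertex of $T$ of outdegree $i$) is $$\binom{2n-i-1}{n-1}.$$
   Context: A plane tree is a (nonempty, finite) rooted tree, with unlabelled (indistinguishable) vertices, in which the subtrees at every vertex are linearly ordered; plane trees are counted up to isomorphism preserving the root and these orders. The outdegree of a vertex is the number of its subtrees (children). The vertices of a given tree are counted as distinct positions in the tree. Convention: $\binom{a}{b}=0$ unless $0\le b\le a$. *)

(* Defs.v *)
From mathcomp Require Import all_boot all_order all_algebra.

Set Implicit Arguments.
Unset Strict Implicit.
Unset Printing Implicit Defensive.

(* An isomorphism of plane trees preserves the root and the order of the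
   subtrees, so isomorphism classes are exactly the terms of this type, up to
   Leibniz equality. *)
Inductive plane_tree : Type := Node of seq plane_tree.

Definition subtrees (t : plane_tree) : seq plane_tree := let: Node ts := t in ts.

(* Each child contributes the edge leading to it and the edges below it. *)
Fixpoint num_edges (t : plane_tree) : nat :=
  let: Node ts := t in sumn [seq (num_edges s).+1 | s <- ts].

(* A vertex is encoded by its address: the 0-based child indices along the path
   from the root to it. Addresses that leave the tree give None. *)
Fixpoint subtree_at (t : plane_tree) (v : seq nat) : option plane_tree :=
  if v is k :: v' then
    if onth (subtrees t) k is Some s then subtree_at s v' else None
  else Some t.

Definition is_vertex (t : plane_tree) (v : seq nat) : bool :=
  isSome (subtree_at t v).

(* The value 0 off the tree is junk. *)
Definition outdegree (t : plane_tree) (v : seq nat) : nat :=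
  if subtree_at t v is Some s then size (subtrees s) else 0.

(* Integer arguments: with truncated subtraction on nat, a negative upper
   argument would become 0, and 'C(0, 0) = 1 where the value must be 0. *)
Definition binz (a b : int) : nat :=
  if (0 <= b <= a)%R then 'C(`|a|%N, `|b|%N) else 0.

(* Main.v *)
Require Import Defs.
From mathcomp Require Import all_boot all_order all_algebra.
From mathcomp Require Import all_classical.
From mathcomp Require Import zify.

Local Open Scope classical_set_scope.
Local Open Scope card_scope.

(** Cutting a pair (T, v) along the path from the root to v leaves, for each edge
    of the path, the siblings to its left and those to its right, together with
    the list of the i subtrees at v. The siblings on one side are collected into
    a single tree, so (T, v) becomes a list of pairs of trees (the spine)
    followed by a list of i trees.

    Let g(k, m) be the number of such configurations with k trees in the second
    list and m edges in total, each spine entry counting for one extra edge.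
    If the second list is nonempty, its first tree either is a single vertex,
    which is dropped, or is split by deleting the edge to its first child; hence
    g(k+1, m) = g(k, m) + g(k+2, m-1). If it is empty, the first spine entry can
    be moved to it, so g(0, m) = g(2, m-1) for m > 0. These are Pascal's rule
    and the symmetry rule for g(k, m) = C(2m + k - 1, m), and m = n - i, k = i
    gives the result. *)

Lemma card_II_setU (T : Type) (A B : set T) (a b : nat) :
  A `&` B = set0 -> A #= `I_a -> B #= `I_b -> A `|` B #= `I_(a + b).
Proof.
elim: a A => [|a IHa] A disjAB.
  by rewrite II0 card_eq0 => /eqP ->; rewrite set0U.
move=> /eq_cardSP[x Ax cardA] cardB; rewrite addSn; apply/eq_cardSP.
exists x; first by left.
have nBx : ~ B x by move=> Bx; have : (A `&` B) x by []; rewrite disjAB.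
rewrite setDUl [B `\ x]not_setD1//.
by apply: IHa => //; rewrite -subset0 -disjAB => y [[]].
Qed.

Definition forest_edges (ts : seq plane_tree) : nat :=
  sumn [seq num_edges t | t <- ts].

Definition spine : Type := seq (plane_tree * plane_tree).

Definition spine_edges (c : spine) : nat :=
  sumn [seq (num_edges p.1 + num_edges p.2).+1 | p <- c].

Definition configurations (k m : nat) : set (spine * seq plane_tree) :=
  [set s | size s.2 = k /\ spine_edges s.1 + forest_edges s.2 = m].

(** This and [graft] run against the decompositions, rebuilding the larger configuration. Both are
    the identity on forests of the wrong shape, so their injectivity is claimed only on the
    configurations they serve. *)
Definition extend_spine (s : spine * seq plane_tree) : spine * seq plane_tree :=
  if s is (c, [:: l; r]) then ((l, r) :: c, [::]) else s.

Definition add_leaf (s : spine * seq plane_tree) : spine * seq plane_tree :=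
  (s.1, Node [::] :: s.2).

Definition graft (s : spine * seq plane_tree) : spine * seq plane_tree :=
  if s is (c, t :: Node us :: ts) then (c, Node (t :: us) :: ts) else s.

Lemma configurations00 : configurations 0 0 = [set ([::], [::])].
Proof.
apply/seteqP; split=> [[c ts] [/= /size0nil -> /eqP]|s ->//].
by rewrite addn_eq0 => /andP[+ _]; case: c.
Qed.

Lemma configurations0S (m : nat) :
  configurations 0 m.+1 = extend_spine @` configurations 2 m.
Proof.
apply/seteqP; split=> [[c ts] [/= /size0nil -> ]|_ [[c ts] [/= + +] <-]].
  case: c => [//|[l r] c] /=; rewrite /spine_edges/= => cm.
  exists (c, [:: l; r]) => //; split=> //=.
  by move: cm; rewrite /spine_edges /forest_edges/=; lia.
case: ts => [|l [|r []]]//= _; rewrite /configurations /spine_edges/=.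
by rewrite /forest_edges/= => cm; split=> //; lia.
Qed.

Lemma configurationsS0 (k : nat) :
  configurations k.+1 0 = add_leaf @` configurations k 0.
Proof.
apply/seteqP; split=> [[c [|[[|s us]] ts]] []//=|_ [s [? ?] <-]].
- by move=> [sz] cm; exists (c, ts).
- by rewrite /forest_edges/=; lia.
- by split=> //=; congr S.
Qed.

Lemma configurationsSS (k m : nat) : configurations k.+1 m.+1 =
  add_leaf @` configurations k m.+1 `|` graft @` configurations k.+2 m.
Proof.
apply/seteqP; split=> [[c [|[[|s us]] ts]] []//= [sz] cm|].
- by left; exists (c, ts).
- right; exists (c, s :: Node us :: ts) => //; split=> /=; first by rewrite sz.
  by move: cm; rewrite /forest_edges/=; lia.
- move=> _ [[s [sz cm] <-]|[[c [|t [|[us] ts]]] []//= [sz] cm <-]].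
    by split=> //=; congr S.
  by split=> /=; [rewrite sz|move: cm; rewrite /forest_edges/=; lia].
Qed.

Lemma extend_spine_inj (m : nat) :
  {in configurations 2 m &, injective extend_spine}.
Proof.
move=> [c ts] [c' ts'] /set_mem[/= + _] /set_mem[/= + _].
by case: ts => [|l [|r []]]// _; case: ts' => [|l' [|r' []]]// _ [-> -> ->].
Qed.

Lemma add_leaf_inj : injective add_leaf.
Proof. by move=> [c ts] [c' ts'] [-> ->]. Qed.

Lemma graft_inj (k m : nat) : {in configurations k.+2 m &, injective graft}.
Proof.
move=> [c ts] [c' ts'] /set_mem[/= + _] /set_mem[/= + _].
case: ts => [|t [|[us] ts]]// _; case: ts' => [|t' [|[us'] ts']]// _.
by move=> [-> -> -> ->].
Qed.

(** The first tree of the forest is a leaf on one side and has a child on the other. *)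
Lemma add_leaf_graft_disjoint (k m : nat) (A : set (spine * seq plane_tree)) :
  add_leaf @` A `&` graft @` configurations k.+2 m = set0.
Proof.
rewrite -subset0 => _ [[s _ <-] [[c ts] [/= + _]]].
by case: ts => [|t [|[us] ts]].
Qed.

(** Induction on m, then on k; the outer hypothesis covers all k because the recurrence trades one
    edge for a larger k. The predecessor truncates only at k = m = 0, where C(0, 0) = 1 counts the
    empty configuration. *)
Lemma card_configurations (k m : nat) :
  configurations k m #= `I_('C((2 * m + k).-1, m)).
Proof.
elim: m k => [|m IHm] k.
  rewrite bin0; elim: k => [|k IHk]; first by rewrite configurations00 card_set1.
  rewrite configurationsS0; apply: card_eq_trans IHk.
  by apply: inj_card_eq => s s' _ _; exact: add_leaf_inj.
elim: k => [|k IHk].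
  rewrite configurations0S.
  (* Both upper arguments are 2m + 1, the sum of the two lower ones. *)
  have -> : 'C((2 * m.+1 + 0).-1, m.+1) = 'C((2 * m + 2).-1, m).
    by rewrite -bin_sub; [congr 'C(_, _); lia|lia].
  by apply: card_eq_trans (IHm 2); exact/inj_card_eq/extend_spine_inj.
rewrite configurationsSS.
have -> : 'C((2 * m.+1 + k.+1).-1, m.+1) =
    'C((2 * m.+1 + k).-1, m.+1) + 'C((2 * m + k.+2).-1, m).
  have -> : (2 * m.+1 + k.+1).-1 = (2 * m.+1 + k).-1.+1 by lia.
  by rewrite binS; congr (_ + 'C(_, _)); lia.
apply: card_II_setU; first exact: add_leaf_graft_disjoint.
  by apply: card_eq_trans IHk; apply: inj_card_eq => s s' _ _; exact: add_leaf_inj.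
by apply: card_eq_trans (IHm _); exact/inj_card_eq/graft_inj.
Qed.

(** The spine is a zipper read from the root downwards; the roots of [l] and [r] merely hold the
    siblings together. *)
Fixpoint plug (c : spine) (u : plane_tree) : plane_tree :=
  if c is (l, r) :: c' then Node (subtrees l ++ plug c' u :: subtrees r) else u.

(** A 0-based child index is the number of siblings to the left. *)
Definition address (c : spine) : seq nat := [seq size (subtrees p.1) | p <- c].

Lemma subtree_at_plug (c : spine) (u : plane_tree) :
  subtree_at (plug c u) (address c) = Some u.
Proof. by elim: c => [//|[l r] c IHc] /=; rewrite onth_cat ltnn subnn. Qed.

Lemma num_edges_Node (ts : seq plane_tree) :
  num_edges (Node ts) = forest_edges ts + size ts.
Proof. by rewrite /forest_edges /=; elim: ts => //= t ts ->; lia. Qed.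

Lemma num_edges_plug (c : spine) (u : plane_tree) :
  num_edges (plug c u) = spine_edges c + num_edges u.
Proof.
elim: c => [//|[[ls] [rs]] c IHc].
have -> : spine_edges ((Node ls, Node rs) :: c) =
    (num_edges (Node ls) + num_edges (Node rs)).+1 + spine_edges c by [].
have -> : plug ((Node ls, Node rs) :: c) u = Node (ls ++ plug c u :: rs) by [].
rewrite !num_edges_Node /forest_edges map_cat sumn_cat size_cat map_cons.
by rewrite [sumn (_ :: _)]/= [size (_ :: _)]/= IHc; lia.
Qed.

(** Equal addresses force equally many left siblings at each level, so the lists of children split
    at the same place. *)
Lemma plug_inj (c c' : spine) (u u' : plane_tree) :
  plug c u = plug c' u' -> address c = address c' -> c = c' /\ u = u'.
Proof.
elim: c c' => [|[[ls] [rs]] c IHc] [|[[ls'] [rs']] c']//= [eqT] [eqsz eqv].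
have := congr1 (take (size ls)) eqT; rewrite take_size_cat// eqsz take_size_cat//.
have := congr1 (drop (size ls)) eqT; rewrite drop_size_cat// eqsz drop_size_cat//.
by move=> [/IHc/(_ eqv)[-> ->] ->] ->.
Qed.

Lemma plug_surj (t u : plane_tree) (v : seq nat) : subtree_at t v = Some u ->
  exists2 c : spine, t = plug c u & v = address c.
Proof.
elim: v t => [|k v IHv] [ts] /=; first by move=> [<-]; exists [::].
case def_s: (onth ts k) => [s|//] /IHv[c def_c ->].
have ltk : k < size ts by rewrite -onthTE def_s.
exists ((Node (take k ts), Node (drop k.+1 ts)) :: c) => /=.
  rewrite -def_c -{1}(cat_take_drop k ts) (drop_nth s ltk).
  by rewrite (onth_nth s _ _ _ def_s).
by rewrite size_takel// ltnW.
Qed.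

Definition marked_trees (n i : nat) : set (plane_tree * seq nat) :=
  [set Tv | [/\ num_edges Tv.1 = n, is_vertex Tv.1 Tv.2 & outdegree Tv.1 Tv.2 = i]].

Definition assemble (s : spine * seq plane_tree) : plane_tree * seq nat :=
  (plug s.1 (Node s.2), address s.1).

Lemma assemble_inj : injective assemble.
Proof.
by move=> [c ts] [c' ts'] [eqT eqv]; have [-> [->]] := plug_inj _ _ _ _ eqT eqv.
Qed.

Lemma marked_trees_lt (n i : nat) : n < i -> marked_trees n i = set0.
Proof.
move=> lt_ni; rewrite -subset0 => -[t v] [/=].
rewrite /is_vertex /outdegree; case def_u: (subtree_at t v) => [[ts]|]//=.
have [c -> _] := plug_surj _ _ _ def_u.
by rewrite num_edges_plug num_edges_Node; lia.
Qed.

(** The i edges from v to its children are counted neither in the spine nor in the forest, hence n -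
    i. *)
Lemma marked_trees_assemble (n i : nat) : i <= n ->
  marked_trees n i = assemble @` configurations i (n - i).
Proof.
move=> le_in; apply/seteqP; split=> [[t v] [/=]|_ [[c ts] [/= sz cm] <-]].
  rewrite /is_vertex /outdegree; case def_u: (subtree_at t v) => [[ts]|]//=.
  have [c -> ->] := plug_surj _ _ _ def_u.
  rewrite num_edges_plug num_edges_Node => cn _ sz.
  by exists (c, ts) => //; split=> //=; lia.
split; rewrite /= ?/is_vertex ?/outdegree ?subtree_at_plug//.
by rewrite num_edges_plug num_edges_Node; lia.
Qed.

Lemma binz_nat (a b : nat) : binz (Posz a) (Posz b) = 'C(a, b).
Proof. by rewrite /binz !lez_nat /=; case: leqP => // /bin_small. Qed.

Theorem theorem1 (n i : nat) (hn : (1 <= n)%N) :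
  [set Tv : plane_tree * seq nat |
     [/\ num_edges Tv.1 = n, is_vertex Tv.1 Tv.2 & outdegree Tv.1 Tv.2 = i]]
  #= `I_(binz (2 * n%:Z - i%:Z - 1)%R (n%:Z - 1)%R).
Proof.
rewrite -/(marked_trees n i); case: (leqP i n) => [le_in|lt_ni].
  (* Here 2n - i is at least n, hence positive, so the predecessor is exact. *)
  have -> : (2 * n%:Z - i%:Z - 1)%R = Posz (2 * (n - i) + i).-1 by lia.
  have -> : (n%:Z - 1)%R = Posz n.-1 by lia.
  rewrite binz_nat -bin_sub; last by lia.
  have -> : (2 * (n - i) + i).-1 - n.-1 = n - i by lia.
  rewrite marked_trees_assemble//.
  apply: card_eq_trans (card_configurations _ _).
  by apply: inj_card_eq => s s' _ _; exact: assemble_inj.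
(* For i > n the upper argument, possibly negative, lies below n - 1. *)
rewrite marked_trees_lt// /binz ifF ?II0 ?card_eq0//.
by apply/negP => /andP[]; lia.
Qed.
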